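(* Let $\mu\in\mathcal C$ be a nonzero nilpotent bracket, and let $\mu(t)$ be the solution of the bracket flow $\dot\mu(t)=-\pi(P_{\mu(t)})\mu(t)$, $\mu(0)=\mu$. Then $\mu(t)$ is defined for all $t\ge0$, and there is a constant $C>0$ such that for all $t>0$, $$\big(Ct+\|\mu\|^{-2}\big)^{-1}\le\|\mu(t)\|^2\le Ct^{-1}.$$ In particular $\mu(t)\to0$ as $t\to\infty$.
   Context: Let $\mathfrak g$ be a real vector space of dimension $2n$ with complex structure $J$ and inner product $\langle\cdot,\cdot\rangle$ for which $J$ is orthogonal; let $e_1,\dots,e_{2n}$ be an orthonormal basis. A bracket is a skew-symmetric bilinear map $\nu:\mathfrak g\times\mathfrak g\to\mathfrak g$ (equivalently a linear map $\Lambda^2\mathfrak g\to\mathfrak g$); $\Lambda^2\mathfrak g$ carries the inner product with $\langle v_1\wedge v_2,w_1\wedge w_2\rangle=\det(\langle v_i,w_j\rangle)$, and $\|\nu\|^2=\sum_{i<j}\|\nu(e_i,e_j)\|^2$. $\mathcal C$ denotes the set of brackets satisfying the Jacobi identity and $\nu(J\cdot,\cdot)=J\nu(\cdot,\cdot)$ (complex Lie brackets). For $A\in\mathrm{End}(\mathfrak g)$, $\pi(A)\nu=A\nu(\cdot,\cdot)-\nu(A\cdot,\cdot)-\nu(\cdot,A\cdot)$. $P_\nu:=\nu\nu^*\in\mathrm{End}(\mathfrak g)$, i.e. $P_\nu v=\sum_{i<j}\langle v,\nu(e_i,e_j)\rangle\nu(e_i,e_j)$ (this is the endomorphism representing the $\mathrm{HCF}_+$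 tensor $\Theta$ of the left-invariant metric $\langle\cdot,\cdot\rangle$ on the complex Lie group with Lie algebra $(\mathfrak g,\nu)$). *)

(* Defs.v *)
From HB Require Import structures.
From mathcomp Require Import all_boot all_order all_algebra.
From mathcomp Require Import all_classical all_reals all_analysis.
Set Implicit Arguments. Unset Strict Implicit. Unset Printing Implicit Defensive.
Import Order.TTheory GRing.Theory Num.Theory.
Import numFieldNormedType.Exports.
Local Open Scope classical_set_scope.
Local Open Scope ring_scope.

(* g = R^m (column vectors), orthonormal basis e_i = standard basis,
   inner product <v,w> = v^T w.  A bracket is given by its values on
   pairs of basis vectors: mu i j = mu(e_i, e_j). *)
Definition bracket (R : realType) (m : nat) := 'I_m -> 'I_m -> 'cV[R]_m.

Section Brackets.
Variables (R : realType) (m : nat).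

Definition evec (i : 'I_m) : 'cV[R]_m := delta_mx i 0.

Definition dotv (v w : 'cV[R]_m) : R := \sum_(k < m) v k 0 * w k 0.

Definition bapp (mu : bracket R m) (v w : 'cV[R]_m) : 'cV[R]_m :=
  \sum_(i < m) \sum_(j < m) (v i 0 * w j 0) *: mu i j.

Definition skew_bracket (mu : bracket R m) : Prop :=
  forall i j, mu i j = - mu j i.

Definition jacobi (mu : bracket R m) : Prop :=
  forall u v w, bapp mu (bapp mu u v) w + bapp mu (bapp mu v w) u
                + bapp mu (bapp mu w u) v = 0.

Definition J_complex (J : 'M[R]_m) (mu : bracket R m) : Prop :=
  forall u v, bapp mu (J *m u) v = J *m bapp mu u v.

Definition in_C (J : 'M[R]_m) (mu : bracket R m) : Prop :=
  skew_bracket mu /\ jacobi mu /\ J_complex J mu.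

Fixpoint lnested (mu : bracket R m) (v : nat -> 'cV[R]_m) (k : nat) : 'cV[R]_m :=
  match k with
  | 0 => v 0%N
  | k'.+1 => bapp mu (lnested mu v k') (v k)
  end.

(* nilpotent: the lower central series terminates, i.e. all sufficiently
   long iterated brackets vanish *)
Definition nilpotent_bracket (mu : bracket R m) : Prop :=
  exists k : nat, forall v : nat -> 'cV[R]_m, lnested mu v k = 0.

Definition bnorm2 (mu : bracket R m) : R :=
  \sum_(i < m) \sum_(j < m | (i < j)%N) dotv (mu i j) (mu i j).

(* P_nu = nu nu^* : v |-> sum_{i<j} <v, nu(e_i,e_j)> nu(e_i,e_j) *)
Definition Pmat (mu : bracket R m) : 'M[R]_m :=
  \sum_(i < m) \sum_(j < m | (i < j)%N) (mu i j *m (mu i j)^T).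

Definition pi_act (A : 'M[R]_m) (mu : bracket R m) : bracket R m :=
  fun i j => A *m mu i j - bapp mu (A *m evec i) (evec j)
             - bapp mu (evec i) (A *m evec j).

Definition flow_rhs (mu : bracket R m) : bracket R m :=
  fun i j => - pi_act (Pmat mu) mu i j.

Definition bracket_flow_sol (mu0 : bracket R m) (mu : R -> bracket R m) : Prop :=
  (forall i j, mu 0 i j = mu0 i j) /\
  (forall i j (k : 'I_m),
      {within [set x : R | 0 <= x]%classic, continuous (fun t => mu t i j k 0)}) /\
  (forall t : R, 0 < t -> forall i j (k : 'I_m),
      derivable (fun s => mu s i j k 0) t 1 /\
      derive1 (fun s => mu s i j k 0) t = flow_rhs (mu t) i j k 0).

End Brackets.

(* Main.v *)
Require Import Defs.
From HB Require Import structures.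
From mathcomp Require Import all_boot all_order all_algebra.
From mathcomp Require Import all_classical all_reals all_analysis.
From mathcomp Require Import ring lra zify.
Import Order.TTheory GRing.Theory Num.Theory.
Import numFieldNormedType.Exports.
Local Open Scope classical_set_scope.
Local Open Scope ring_scope.

(** Along a solution [mu(t)] write [P = P_mu(t)] and solve [h' = - P h],
    [h(0) = 1]. Then [mu(t) = h . mu0], and with [k = h^-1] the inverse metric
    [H = k k^T] satisfies the quadratic equation [H' = 2 B(H, H)], where
    [B(X, Y) = mu0 (X /\ Y) mu0^*]. Its power series solution has positive
    semidefinite coefficients, and nilpotency of [mu0] makes all but finitely
    many of them vanish, so [H] is a polynomial in [t] and hence exists for all
    [t >= 0]. Conversely [h] and [mu(t)] are recovered from [H] through a linear
    equation. Since [P = h H' h^T / 2], the norm is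
    [||mu(t)||^2 = tr P = tr (h H' h^T) / 2]. The upper bound follows from
    [t H' <= deg(H) H] and [h H h^T = 1]; the lower bound from [H'' >= 0], which
    gives [(||mu||^2)' >= - 2 tr (P^2) >= - 2 m^2 ||mu||^4]. *)

Set Implicit Arguments. Unset Strict Implicit. Unset Printing Implicit Defensive.

(** * Functions differentiable for positive times *)

Section C1.
Variable R : realType.
Implicit Types (f g : R -> R).

(** Derivatives are asked for at positive times only, as in [bracket_flow_sol], but continuity on
    the whole line: functions on [[0, +oo)] are extended to negative times, often by their value at
    0, so that no one-sided limits enter the calculus. *)
Definition c1 f f' := continuous f /\ forall t : R, 0 < t -> is_derive t 1 f (f' t).

Lemma c1_eq f f' g' : c1 f f' -> (forall t, 0 < t -> f' t = g' t) -> c1 f g'.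
Proof. by move=> [cf df] e; split=> // t t0; rewrite -e//; exact: df. Qed.

Lemma c1_cst (a : R) : c1 (fun=> a) (fun=> 0).
Proof. by split=> [x|t _]; [exact: cvg_cst|exact: is_derive_cst]. Qed.

Lemma c1_id : c1 id (fun=> 1).
Proof. by split=> [x|t _]; [exact: cvg_id|exact: is_derive_id]. Qed.

Lemma c1_horner (p : {poly R}) : c1 (horner p) (horner p^`()).
Proof. by split=> [|t _]; [exact: continuous_horner|exact: is_derive_poly]. Qed.

Lemma c1D f f' g g' : c1 f f' -> c1 g g' ->
  c1 (fun t => f t + g t) (fun t => f' t + g' t).
Proof.
move=> [cf df] [cg dg]; split=> [x|t t0]; first by apply: cvgD; [exact: cf|exact: cg].
by apply: is_deriveD; [exact: df|exact: dg].
Qed.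

Lemma c1N f f' : c1 f f' -> c1 (fun t => - f t) (fun t => - f' t).
Proof.
move=> [cf df]; split=> [x|t t0]; first by apply: cvgN; exact: cf.
by apply: is_deriveN; exact: df.
Qed.

Lemma c1M f f' g g' : c1 f f' -> c1 g g' ->
  c1 (fun t => f t * g t) (fun t => f' t * g t + f t * g' t).
Proof.
move=> [cf df] [cg dg]; split=> [x|t t0]; first by apply: cvgM; [exact: cf|exact: cg].
apply: is_derive_eq; first by apply: is_deriveM; [exact: df|exact: dg].
by rewrite /GRing.scale/= addrC mulrC.
Qed.

Lemma continuous_sum (I : Type) (r : seq I) (P : pred I) (F : I -> R -> R) :
  (forall i, continuous (F i)) -> continuous (fun t => \sum_(i <- r | P i) F i t).
Proof.
move=> cF; elim: r => [|i r IH].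
  by under eq_fun do rewrite big_nil; move=> x; exact: cvg_cst.
under eq_fun do rewrite big_cons; case: (P i) => //.
by move=> x; apply: cvgD; [exact: cF|exact: IH].
Qed.

Lemma c1_sum (I : finType) (F F' : I -> R -> R) :
  (forall i, c1 (F i) (F' i)) ->
  c1 (fun t => \sum_i F i t) (fun t => \sum_i F' i t).
Proof.
move=> H.
have -> : (fun t => \sum_i F i t) = \sum_i F i by apply/funext => t; rewrite fct_sumE.
have -> : (fun t => \sum_i F' i t) = \sum_i F' i by apply/funext => t; rewrite fct_sumE.
elim/big_ind2 : _ => [|f f' g g' Hf Hg|i _]; [exact: c1_cst|exact: c1D|exact: H].
Qed.

Lemma c1_ler0 f f' (t : R) : c1 f f' -> 0 <= t ->
  (forall s, 0 < s < t -> f' s <= 0) -> f t <= f 0.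
Proof.
move=> [cf df] t0 f'0.
have [->//|tn0] := eqVneq t 0.
have tp : 0 < t by rewrite lt_def tn0.
have [||c] := @MVT R f f' 0 t tp.
- by move=> x; rewrite in_itv/= => /andP[x0 _]; exact: df.
- exact: continuous_subspaceT.
rewrite in_itv/= => /f'0 c0 e; rewrite -subr_le0 e subr0.
exact: mulr_le0_ge0.
Qed.

Lemma c1_const f f' (t : R) : c1 f f' -> 0 <= t ->
  (forall s, 0 < s < t -> f' s = 0) -> f t = f 0.
Proof.
move=> cf t0 f'0; apply/eqP; rewrite eq_le (c1_ler0 cf)//=; last first.
  by move=> s /f'0 ->.
rewrite -lerN2; apply: (c1_ler0 (c1N cf)) => // s /f'0 ->.
by rewrite oppr0.
Qed.

(** Both [f - g] and [- f - g] vanish at 0 and have nonpositive derivative, hence stay nonpositive.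
    This takes the place of estimating an integral. *)
Lemma c1_norm_le f f' g g' (t : R) : c1 f f' -> c1 g g' -> 0 <= t ->
  f 0 = 0 -> g 0 = 0 ->
  (forall s, 0 < s < t -> `|f' s| <= g' s) -> `|f t| <= g t.
Proof.
move=> cf cg t0 f0 g0 H; rewrite ler_norml lerNl; apply/andP; split.
  have := c1_ler0 (c1D (c1N cf) (c1N cg)) t0.
  rewrite f0 g0 oppr0 addr0 subr_le0; apply => s /H.
  by rewrite ler_norml => /andP[? _]; rewrite subr_le0 lerNl.
have := c1_ler0 (c1D cf (c1N cg)) t0.
rewrite f0 g0 oppr0 addr0 subr_le0; apply => s /H.
by rewrite ler_norml => /andP[_ ?]; rewrite subr_le0.
Qed.

Lemma continuous_max0 f : continuous f -> continuous (fun t : R => f (Num.max t 0)).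
Proof.
move=> cf x; apply: (@cvg_comp _ _ _ (fun t : R => Num.max t 0) f _ (nbhs (Num.max x 0))).
  by apply: (@continuous_max R R id (fun=> 0)); [exact: cvg_id|exact: cvg_cst].
exact: cf.
Qed.

(* Starting the integral at -1 makes 0 an interior point, so that the primitive
   is differentiable, hence continuous, at 0. *)
Definition primitive f (t : R) : R :=
  let G x := \int[@lebesgue_measure R]_(s in `[-1, x]) f s in
  G (Num.max t 0) - G 0.

Lemma primitive0 f t : t <= 0 -> primitive f t = 0.
Proof. by move=> t0; rewrite /primitive (max_idPr t0) subrr. Qed.

Lemma c1_primitive f : continuous f -> c1 (primitive f) f.
Proof.
move=> cf; set G := fun x : R => \int[@lebesgue_measure R]_(s in `[-1, x]) f s.
have dG (x : R) : -1 < x -> derivable G x 1 /\ derive1 G x = f x.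
  move=> x1; apply: (@continuous_FTC1_closed R f (-1) x (x + 1)) => //.
  - by rewrite ltrDl.
  - apply: continuous_compact_integrable; first exact: segment_compact.
    exact: continuous_subspaceT.
  - exact: cf.
have cG (x : R) : -1 < x -> {for x, continuous G}.
  by move=> /dG[dG1 _]; apply: differentiable_continuous; apply/derivable1_diffP.
split=> [x|t t0].
  apply: (@cvgB _ R^o); last exact: cvg_cst.
  apply: (@cvg_comp _ _ _ (fun t : R => Num.max t 0) G _ (nbhs (Num.max x 0))).
    by apply: (@continuous_max R R id (fun=> 0)); [exact: cvg_id|exact: cvg_cst].
  apply: cG; rewrite lt_max; apply/orP; right; lra.
apply: (@near_eq_is_derive _ _ _ (fun t => G t - G 0)).
  near=> s; rewrite /primitive -/G (_ : Num.max s 0 = s)//.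
  by apply/max_idPl/ltW; near: s; exact: lt_nbhsr.
have [d1 d2] := dG t (lt_trans (ltrN10 R) t0).
apply: is_derive_eq.
  apply: (@is_deriveB _ _ _ G (cst (G 0))).
    by apply: derivableP; exact: d1.
by rewrite subr0 -derive1E.
Unshelve. all: by end_near.
Qed.

Lemma continuous_bounded_itv f (T : R) : continuous f ->
  exists2 M : R, 0 <= M & forall t, 0 <= t <= T -> `|f t| <= M.
Proof.
move=> cf; have [T0|T0] := leP 0 T; last first.
  by exists 0 => // t /andP[t0 /(le_trans t0)]; rewrite leNgt T0.
have cn : {within `[0, T], continuous (fun t => `|f t|)}.
  by apply: continuous_subspaceT => x; apply: cvg_norm; exact: cf.
have [c _ H] := EVT_max T0 cn.
by exists `|f c| => // t tT; apply: H; rewrite in_itv.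
Qed.

Lemma continuous_within_max0 (f : R -> R) :
  {within [set x : R | 0 <= x], continuous f} ->
  continuous (fun t : R => f (Num.max t 0)).
Proof.
move=> cf x; set y := Num.max x 0.
have Ay : [set x : R | 0 <= x] y by rewrite /= le_max lexx orbT.
have cfy : f @ within [set x : R | 0 <= x] (nbhs y) --> f y.
  by move/subspace_continuousP: cf; exact.
apply: (@cvg_comp _ _ _ (fun t : R => Num.max t 0) f _ _ _ _ cfy) => U /= HU.
have cmax : (fun t : R => Num.max t 0) @ x --> y.
  by apply: (@continuous_max R R id (fun=> 0)); [exact: cvg_id|exact: cvg_cst].
have HxU : \forall t \near x, 0 <= Num.max t 0 -> U (Num.max t 0) by exact: (cmax _ HU).
change (\forall t \near x, U (Num.max t 0)).
by apply: filterS HxU => t; apply; rewrite le_max lexx orbT.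
Qed.

Lemma c1V (f f' : R -> R) : c1 f f' -> (forall t, f t != 0) ->
  c1 (fun t => (f t)^-1) (fun t => - (f t) ^- 2 * f' t).
Proof.
move=> [cf df] f0; split=> [x|t t0]; first by apply: cvgV => //; exact: cf.
have d := df t t0.
apply: DeriveDef; first by apply: derivableV => //; exact: ex_derive.
by rewrite deriveV ?derive_val//.
Qed.

(** A derivative at [t > 0] only sees nearby positive times. Continuity of [f] is a separate
    hypothesis because [g] may differ from [f] at negative times. *)
Lemma c1_near (f g f' : R -> R) : continuous f -> c1 g f' ->
  (forall t, 0 <= t -> f t = g t) -> c1 f f'.
Proof.
move=> cf [_ dg] fg; split=> // t t0.
apply: (@near_eq_is_derive _ _ _ g); last exact: dg.
near=> s; rewrite fg//; apply: ltW; near: s; exact: lt_nbhsr.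
Unshelve. all: by end_near.
Qed.

End C1.

(** * Linear differential equations *)

Section LinearODE.
Variable R : realType.

Lemma series_dominated (a c : R^nat) : (forall k, `|a k| <= c k) ->
  cvgn (series c) -> cvgn (series a) /\
  forall n, `|limn (series a) - series a n| <= limn (series c) - series c n.
Proof.
move=> ac cc.
have ca : cvgn (series a).
  apply: (@normed_cvg R R^o); apply: (series_le_cvg _ _ _ cc) => n /=.
  - exact: normr_ge0.
  - exact: (le_trans (normr_ge0 _) (ac n)).
  - exact: ac.
split=> // n.
apply: (@ler_cvg_to _ \oo _ _ (fun N => `|series a N - series a n|)
   (fun N => series c N - series c n)).
- apply: cvg_norm; apply: cvgB; [exact: ca|exact: cvg_cst].
- by apply: cvgB; [exact: cc|exact: cvg_cst].
near=> N.
have nN : (n <= N)%N by near: N; exact: nbhs_infty_ge.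
rewrite !sub_series_geq//.
by apply: (le_trans (ler_norm_sum _ _ _)); apply: ler_sum => i _; exact: ac.
Unshelve. all: by end_near.
Qed.

Lemma c1_exp_coeff (M : R) n :
  c1 (fun t => exp_coeff (M * t) n.+1) (fun t => M * exp_coeff (M * t) n).
Proof.
have := c1_horner ((M ^+ n.+1 / (n.+1)`!%:R) *: 'X^(n.+1)).
have -> : horner ((M ^+ n.+1 / (n.+1)`!%:R) *: 'X^(n.+1)) =
    (fun t => exp_coeff (M * t) n.+1).
  by apply/funext => t; rewrite hornerZ hornerXn /exp_coeff /= exprMn mulrAC.
move=> H; apply: (c1_eq H) => t t0.
rewrite derivZ derivXn hornerZ hornerMn hornerXn /exp_coeff /= exprMn factS natrM.
have ? : n`!%:R != 0 :> R by rewrite pnatr_eq0 -lt0n fact_gt0.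
have ? : n.+1%:R != 0 :> R by rewrite pnatr_eq0.
by rewrite exprS -mulr_natl; field; apply/andP; split.
Qed.

Definition mc1 p q (X X' : R -> 'M[R]_(p, q)) :=
  forall i j, c1 (fun t => X t i j) (fun t => X' t i j).

Variables (m : nat) (A : R -> 'M[R]_m).
Hypothesis cA : forall i j, continuous (fun t => A t i j).

Lemma continuous_mulmx_entry (Y : R -> 'M[R]_m) :
  (forall i j, continuous (fun t => Y t i j)) ->
  forall i j, continuous (fun t => (A t *m Y t) i j).
Proof.
move=> cY i j.
rewrite (_ : (fun t => _) = (fun t => \sum_l A t i l * Y t l j)); last first.
  by apply/funext => t; rewrite mxE.
apply: continuous_sum => l x.
by apply: cvgM; [exact: cA|exact: cY].
Qed.

(** The increments of Picard iteration rather than the iterates: their sum is the Peano-Baker series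
    of [X' = A X], [X 0 = 1]. *)
Fixpoint picard (n : nat) : R -> 'M[R]_m :=
  if n is n'.+1 then
    fun t => \matrix_(i, j) primitive (fun s => (A s *m picard n' s) i j) t
  else fun=> 1%:M.

Lemma continuous_picard n i j : continuous (fun t => picard n t i j).
Proof.
elim: n i j => [|n IH] i j /=; first by move=> x; exact: cvg_cst.
rewrite (_ : (fun t => _) = primitive (fun s => (A s *m picard n s) i j)).
  by have [] := c1_primitive (continuous_mulmx_entry IH (i:=i) (j:=j)).
by apply/funext => t; rewrite mxE.
Qed.

Lemma mc1_picard n : mc1 (picard n.+1) (fun t => A t *m picard n t).
Proof.
move=> i j /=.
rewrite (_ : (fun t => _) = primitive (fun s => (A s *m picard n s) i j)).
  by apply: c1_primitive; apply: continuous_mulmx_entry; exact: continuous_picard.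
by apply/funext => t; rewrite mxE.
Qed.

Lemma picardS0 n t : t <= 0 -> picard n.+1 t = 0.
Proof. by move=> t0; apply/matrixP => i j; rewrite !mxE primitive0. Qed.

(** Each increment is compared with the matching term of an exponential series, whose derivative is
    a multiple of the previous term; the matrix product costs the factor [m]. *)
Lemma picard_le (T L : R) :
  (forall t i j, 0 <= t <= T -> `|A t i j| <= L) ->
  forall n t i j, t <= T ->
    `|picard n t i j| <= exp_coeff (m%:R * L * Num.max T 0) n.
Proof.
move=> AL.
have H n t i j : 0 <= t <= T -> `|picard n t i j| <= exp_coeff (m%:R * L * t) n.
  elim: n t i j => [|n IH] t i j /andP[t0 tT].
    by rewrite /exp_coeff /= expr0 divr1 mxE; case: (i == j); rewrite ?normr1 ?normr0.
  apply: (c1_norm_le (@mc1_picard n i j) (c1_exp_coeff (m%:R * L) n)) => //.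
  - by rewrite picardS0// mxE.
  - by rewrite /exp_coeff /= mulr0 expr0n mul0r.
  move=> s /andP[s0 st].
  have sT : 0 <= s <= T by rewrite (ltW s0) (le_trans (ltW st)).
  rewrite mxE; apply: (le_trans (ler_norm_sum _ _ _)).
  apply: (@le_trans _ _ (\sum_(l < m) L * exp_coeff (m%:R * L * s) n)).
    by apply: ler_sum => l _; rewrite normrM ler_pM//; [exact: AL|exact: IH].
  by rewrite sumr_const card_ord -[X in X <= _]mulr_natl mulrA.
move=> n t i j tT.
have L0 : 0 <= T -> 0 <= L by move=> T0; rewrite (le_trans _ (AL 0 i j _))// lexx.
have [t0|t0] := leP 0 t.
  have T0 := le_trans t0 tT.
  rewrite (max_idPl T0); apply: (le_trans (H n _ _ _ _)); first by rewrite t0.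
  rewrite /exp_coeff /= ler_pM2r ?invr_gt0 ?ltr0n ?fact_gt0// lerXn2r ?nnegrE//.
  - by rewrite !mulr_ge0// L0.
  - by rewrite !mulr_ge0// L0.
  by rewrite ler_wpM2l// mulr_ge0// L0.
have E0 : 0 <= m%:R * L * Num.max T 0.
  have [T0|T0] := leP 0 T; last by rewrite mulr0.
  by rewrite !mulr_ge0// L0.
case: n => [|n].
  by rewrite /exp_coeff /= expr0 divr1 mxE; case: (i == j); rewrite ?normr1 ?normr0.
by rewrite picardS0 ?(ltW t0)// mxE normr0 exp_coeff_ge0.
Qed.

Lemma mx_bounded (T : R) :
  exists2 L, 0 <= L & forall t i j, 0 <= t <= T -> `|A t i j| <= L.
Proof.
have /choice[L HL] : forall ij : 'I_m * 'I_m, exists M : R, 0 <= M /\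
    forall t, 0 <= t <= T -> `|A t ij.1 ij.2| <= M.
  by move=> [i j]; have [M M0 HM] := continuous_bounded_itv T (cA (i:=i) (j:=j)); exists M.
exists (\sum_ij L ij); first by apply: sumr_ge0 => ij _; have [] := HL ij.
move=> t i j tT; rewrite (bigD1 (i, j))//=.
apply: (@le_trans _ _ (L (i, j))); first by have [_ ->] := HL (i, j).
by rewrite lerDl; apply: sumr_ge0 => ij _; have [] := HL ij.
Qed.

Definition picard_sum (t : R) : 'M[R]_m :=
  \matrix_(i, j) limn (series (fun n => picard n t i j)).

(** The error [e] is the remainder of the exponential majorant, so it depends neither on the entry
    nor on the time up to [T]: the convergence is uniform. *)
Lemma picard_sum_dist (T : R) : exists2 e : R^nat, e @ \oo --> 0 &
  forall t i j, t <= T -> series (fun n => picard n t i j) @ \oo --> picard_sum t i j /\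
    forall n, `|picard_sum t i j - series (fun n => picard n t i j) n| <= e n.
Proof.
have [L _ HL] := mx_bounded T.
set E := exp_coeff (m%:R * L * Num.max T 0).
have cE : cvgn (series E) by exact: is_cvg_series_exp_coeff.
exists (fun n => limn (series E) - series E n).
  rewrite -[X in _ --> X](subrr (limn (series E))).
  by apply: cvgB; [exact: cvg_cst|exact: cE].
move=> t i j tT.
have [c1 c2] := series_dominated (fun n => picard_le HL n i j tT) cE.
by split=> [|n]; rewrite mxE.
Qed.

Lemma continuous_picard_sum i j : continuous (fun t => picard_sum t i j).
Proof.
move=> x; have [e e0 He] := picard_sum_dist (x + 1).
apply/cvgrPdist_lt => eps eps0.
have eps3 : 0 < eps / 3 by rewrite divr_gt0.
have /cvgrPdist_lt/(_ _ eps3)[n _ /(_ n (leqnn n)) /= en] := e0.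
have cS : continuous (fun t => series (fun n => picard n t i j) n).
  by apply: continuous_sum => k; exact: continuous_picard.
near=> y.
have yx : y <= x + 1.
  by apply: ltW; near: y; apply: lt_nbhsl; rewrite ltrDl.
have h1 := (He x i j (ltW (ltr_pwDr ltr01 (lexx x)))).2 n.
have h2 := (He y i j yx).2 n.
have h3 : `|series (fun n => picard n x i j) n - series (fun n => picard n y i j) n| < eps / 3.
  by near: y; have /cvgrPdist_lt/(_ _ eps3) := cS x.
have {}en : e n < eps / 3.
  by move: en; rewrite sub0r normrN; apply: le_lt_trans; exact: ler_norm.
rewrite (_ : _ - _ = (picard_sum x i j - series (fun n => picard n x i j) n) +
  (series (fun n => picard n x i j) n - series (fun n => picard n y i j) n) -
  (picard_sum y i j - series (fun n => picard n y i j) n)); last by ring.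
apply: (le_lt_trans (ler_normB _ _)).
apply: (@le_lt_trans _ _ (e n + `|series (fun n => picard n x i j) n - series (fun n => picard n y i j) n| + e n)).
  by rewrite lerD//; apply: (le_trans (ler_normD _ _)); rewrite lerD2r.
by move: en h3; lra.
Unshelve. all: by end_near.
Qed.

(** The partial sums [S n], which omit the constant term, have two limits: the primitive, by the
    uniform error bound, and the series minus its constant term. *)
Lemma picard_sum_primitive t i j : 0 <= t ->
  picard_sum t i j = (1%:M : 'M[R]_m) i j + primitive (fun s => (A s *m picard_sum s) i j) t.
Proof.
move=> t0; have [e e0 He] := picard_sum_dist t.
have [L L0 HL] := mx_bounded t.
set Q := primitive _.
have cQ : c1 Q (fun s => (A s *m picard_sum s) i j).
  by apply/c1_primitive/continuous_mulmx_entry => *; exact: continuous_picard_sum.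
pose S n s := \sum_(k < n) picard k.+1 s i j.
have cS n : c1 (S n) (fun s => \sum_(k < n) (A s *m picard k s) i j).
  by apply: c1_sum => k; exact: mc1_picard.
have QS n : `|Q t - S n t| <= m%:R * L * e n * t.
  have e_ge0 : 0 <= e n by exact: le_trans (normr_ge0 _) ((He t i j (lexx t)).2 n).
  have cg := c1M (c1_cst (m%:R * L * e n)) (@c1_id R).
  apply: (c1_norm_le (c1D cQ (c1N (cS n))) cg) => //.
  - rewrite /Q primitive0// /S big1 ?subr0// => k _.
    by rewrite picardS0// mxE.
  - by rewrite mulr0.
  move=> s /andP[s0 st]; rewrite mul0r add0r mulr1.
  have -> : (A s *m picard_sum s) i j - \sum_(k < n) (A s *m picard k s) i j =
     \sum_l A s i l * (picard_sum s l j - series (fun n => picard n s l j) n).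
    rewrite mxE.
    under [X in _ - X]eq_bigr => k _ do rewrite mxE.
    rewrite exchange_big -sumrB /=; apply: eq_bigr => l _.
    by rewrite mulrBr /series /= big_mkord mulr_sumr.
  apply: (le_trans (ler_norm_sum _ _ _)).
  apply: (@le_trans _ _ (\sum_(l < m) L * e n)).
    apply: ler_sum => l _; rewrite normrM ler_pM//.
      by apply: HL; rewrite !ltW.
    exact: (He s l j (ltW st)).2.
  by rewrite sumr_const card_ord -[X in X <= _]mulr_natl mulrA.
have cvS : (fun n => S n t) @ \oo --> Q t.
  apply/cvgrPdist_le => eps eps0.
  have : (fun n => m%:R * L * e n * t) @ \oo --> (0 : R).
    rewrite -(mul0r t) -(mulr0 (m%:R * L)).
    by apply: cvgM; [apply: cvgM => //; exact: cvg_cst|exact: cvg_cst].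
  move=> /cvgrPdist_le/(_ _ eps0); apply: filterS => n /=.
  rewrite sub0r normrN => H; apply: le_trans (QS n) _.
  exact: le_trans (ler_norm _) H.
have cvX : (fun n => S n t) @ \oo --> picard_sum t i j - (1%:M : 'M[R]_m) i j.
  have := (He t i j (lexx t)).1.
  rewrite -cvg_shiftS => H.
  have : (fun n => series (fun n => picard n t i j) n.+1 - (1%:M : 'M[R]_m) i j) @ \oo -->
     picard_sum t i j - (1%:M : 'M[R]_m) i j.
    by apply: (@cvgB _ R^o); [exact: H|exact: cvg_cst].
  rewrite (_ : (fun n => _) = (fun n => S n t))//; apply/funext => n.
  by rewrite /series /= big_mkord big_ord_recl /= addrAC subrr add0r.
have := cvg_unique _ cvS cvX => // ->; last exact: norm_hausdorff.
by rewrite addrC subrK.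
Qed.

Lemma linear_ode : exists X : R -> 'M[R]_m,
  mc1 X (fun t => A t *m X t) /\ X 0 = 1%:M.
Proof.
exists picard_sum; split; last first.
  by apply/matrixP => i j; rewrite picard_sum_primitive// primitive0// addr0.
move=> i j; split; first exact: continuous_picard_sum.
move=> t t0.
apply: (@near_eq_is_derive _ _ _ (fun t => (1%:M : 'M[R]_m) i j +
   primitive (fun s => (A s *m picard_sum s) i j) t)).
  near=> s; rewrite -picard_sum_primitive//.
  by apply: ltW; near: s; exact: lt_nbhsr.
have cQ : c1 (primitive (fun s => (A s *m picard_sum s) i j)) (fun s => (A s *m picard_sum s) i j).
  by apply/c1_primitive/continuous_mulmx_entry => *; exact: continuous_picard_sum.
have [_ /(_ t t0)] := c1D (c1_cst ((1%:M : 'M[R]_m) i j)) cQ.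
by rewrite add0r.
Unshelve. all: by end_near.
Qed.

End LinearODE.

(** * Calculus of matrix-valued functions *)

Section MatrixC1.
Variable R : realType.

Lemma mc1_eq p q (X X' Y' : R -> 'M[R]_(p, q)) : mc1 X X' ->
  (forall t, 0 < t -> X' t = Y' t) -> mc1 X Y'.
Proof. by move=> dX e i j; apply: (c1_eq (dX i j)) => t t0; rewrite e. Qed.

Lemma mc1_cst p q (X : 'M[R]_(p, q)) : mc1 (fun=> X) (fun=> 0).
Proof. by move=> i j; apply: (c1_eq (c1_cst _)) => t _; rewrite mxE. Qed.

Lemma mc1D p q (X X' Y Y' : R -> 'M[R]_(p, q)) : mc1 X X' -> mc1 Y Y' ->
  mc1 (fun t => X t + Y t) (fun t => X' t + Y' t).
Proof.
move=> dX dY i j; under eq_fun do rewrite mxE.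
by apply: (c1_eq (c1D (dX i j) (dY i j))) => t _; rewrite mxE.
Qed.

Lemma mc1N p q (X X' : R -> 'M[R]_(p, q)) : mc1 X X' ->
  mc1 (fun t => - X t) (fun t => - X' t).
Proof.
move=> dX i j; under eq_fun do rewrite mxE.
by apply: (c1_eq (c1N (dX i j))) => t _; rewrite mxE.
Qed.

Lemma mc1_tr p q (X X' : R -> 'M[R]_(p, q)) : mc1 X X' ->
  mc1 (fun t => (X t)^T) (fun t => (X' t)^T).
Proof.
move=> dX i j; under eq_fun do rewrite mxE.
by apply: (c1_eq (dX j i)) => t _; rewrite mxE.
Qed.

Lemma mc1M p q r (X X' : R -> 'M[R]_(p, q)) (Y Y' : R -> 'M[R]_(q, r)) :
  mc1 X X' -> mc1 Y Y' ->
  mc1 (fun t => X t *m Y t) (fun t => X' t *m Y t + X t *m Y' t).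
Proof.
move=> dX dY i j; under eq_fun do rewrite mxE.
apply: (c1_eq (c1_sum (fun l => c1M (dX i l) (dY l j)))) => t _.
by rewrite !mxE -big_split.
Qed.

Lemma mc1Z p q (f f' : R -> R) (X X' : R -> 'M[R]_(p, q)) :
  c1 f f' -> mc1 X X' ->
  mc1 (fun t => f t *: X t) (fun t => f' t *: X t + f t *: X' t).
Proof.
move=> df dX i j; under eq_fun do rewrite mxE.
by apply: (c1_eq (c1M df (dX i j))) => t _; rewrite !mxE.
Qed.

Lemma mc1_sum (I : finType) p q (X X' : I -> R -> 'M[R]_(p, q)) :
  (forall i, mc1 (X i) (X' i)) ->
  mc1 (fun t => \sum_i X i t) (fun t => \sum_i X' i t).
Proof.
move=> dX i j; under eq_fun do rewrite summxE.
by apply: (c1_eq (c1_sum (fun l => dX l i j))) => t _; rewrite summxE.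
Qed.

Lemma mc1_trace p (X X' : R -> 'M[R]_p) : mc1 X X' ->
  c1 (fun t => \tr (X t)) (fun t => \tr (X' t)).
Proof. by move=> dX; apply: c1_sum => i; exact: dX. Qed.

Lemma mc1_const p q (X X' : R -> 'M[R]_(p, q)) (t : R) : mc1 X X' -> 0 <= t ->
  (forall s, 0 < s < t -> X' s = 0) -> X t = X 0.
Proof.
move=> dX t0 X'0; apply/matrixP => i j.
by apply: (c1_const (dX i j) t0) => s /X'0 ->; rewrite mxE.
Qed.

Lemma linear_ode_r m (A : R -> 'M[R]_m) :
  (forall i j, continuous (fun t => A t i j)) ->
  exists X, mc1 X (fun t => X t *m A t) /\ X 0 = 1%:M.
Proof.
move=> cA; have [|X [dX X0]] := @linear_ode R m (fun t => (A t)^T).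
  by move=> i j; under eq_fun do rewrite mxE; exact: cA.
exists (fun t => (X t)^T); split; last by rewrite X0 trmx1.
by apply: (mc1_eq (mc1_tr dX)) => t _; rewrite trmx_mul trmxK.
Qed.

End MatrixC1.

(** * Positive semidefinite matrices *)

Section PSD.
Variables (R : realType) (m : nat).
Implicit Types X Y : 'M[R]_m.

(** A Gram factorization with any number of columns serves as definition: sums concatenate the
    factors, congruences multiply them, and the trace becomes a sum of squares. *)
Definition psd X := exists p (U : 'M[R]_(m, p)), X = U *m U^T.

Lemma psd0 : psd 0.
Proof. by exists 0%N, 0; rewrite mul0mx. Qed.

Lemma psd1 : psd 1%:M.
Proof. by exists m, 1%:M; rewrite trmx1 mulmx1. Qed.

Lemma psdD X Y : psd X -> psd Y -> psd (X + Y).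
Proof.
by move=> [p [U ->]] [q [V ->]]; exists (p + q)%N, (row_mx U V);
  rewrite tr_row_mx mul_row_col.
Qed.

Lemma psdZ (a : R) X : 0 <= a -> psd X -> psd (a *: X).
Proof.
move=> a0 [p [U ->]]; exists p, (Num.sqrt a *: U).
by rewrite linearZ/= -scalemxAl -scalemxAr scalerA -expr2 sqr_sqrtr.
Qed.

Lemma psd_sum (I : Type) (r : seq I) (P : pred I) (F : I -> 'M[R]_m) :
  (forall i, P i -> psd (F i)) -> psd (\sum_(i <- r | P i) F i).
Proof. by move=> H; apply: big_ind => //; [exact: psd0|exact: psdD]. Qed.

Lemma psd_sym (X : 'M[R]_m) : psd X -> X^T = X.
Proof. by move=> [p [U ->]]; rewrite trmx_mul trmxK. Qed.

Lemma psd_congr (h : 'M[R]_m) X : psd X -> psd (h *m X *m h^T).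
Proof.
by move=> [p [U ->]]; exists p, (h *m U); rewrite trmx_mul !mulmxA.
Qed.

Lemma trace_mul_tr p q (U : 'M[R]_(p, q)) : \tr (U *m U^T) = \sum_i \sum_j U i j ^+ 2.
Proof.
apply: eq_bigr => i _; rewrite mxE; apply: eq_bigr => j _.
by rewrite mxE expr2.
Qed.

Lemma psd_trace_ge0 X : psd X -> 0 <= \tr X.
Proof.
move=> [p [U ->]]; rewrite trace_mul_tr.
by do 2 (apply: sumr_ge0 => ? _); exact: sqr_ge0.
Qed.

Lemma trace_mul_tr_eq0 p q (U : 'M[R]_(p, q)) : \tr (U *m U^T) = 0 -> U = 0.
Proof.
rewrite trace_mul_tr => H; apply/matrixP => i j; rewrite mxE.
have H0 k : 0 <= \sum_j U k j ^+ 2 by apply: sumr_ge0 => ? _; exact: sqr_ge0.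
have Hi : \sum_j U i j ^+ 2 = 0 by exact: (psumr_eq0P (fun i _ => H0 i) H).
have : U i j ^+ 2 = 0 by exact: (psumr_eq0P (fun j _ => sqr_ge0 (U i j)) Hi).
by move/eqP; rewrite sqrf_eq0 => /eqP.
Qed.

(* By AM-GM every entry of U U^T is at most its trace. *)
Lemma psd_trace_sqr X : psd X -> \tr (X *m X) <= (m ^ 2)%:R * (\tr X) ^+ 2.
Proof.
move=> [p [U ->]]; set T := \tr (U *m U^T).
have HT i j : `|(U *m U^T) i j| <= T.
  rewrite mxE; apply: (le_trans (ler_norm_sum _ _ _)).
  have row_le k : \sum_l U k l ^+ 2 <= T.
    rewrite /T trace_mul_tr (bigD1 k)//= lerDl.
    by do 2 (apply: sumr_ge0 => ? _); exact: sqr_ge0.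
  apply: (@le_trans _ _ (2^-1 * (\sum_l U i l ^+ 2 + \sum_l U j l ^+ 2))).
    rewrite -big_split mulr_sumr /=; apply: ler_sum => l _; rewrite mxE normrM.
    have := sqr_ge0 (`|U i l| - `|U j l|).
    by rewrite sqrrB !real_normK ?num_real//; lra.
  have := row_le i; have := row_le j; lra.
have T0 : 0 <= T by apply: psd_trace_ge0; exists p, U.
apply: (@le_trans _ _ (\sum_(i < m) \sum_(j < m) T ^+ 2)).
  apply: ler_sum => i _; rewrite mxE; apply: ler_sum => j _.
  apply: (le_trans (ler_norm _)); rewrite normrM expr2.
  by rewrite ler_pM.
by rewrite !sumr_const !card_ord -mulrnA mulr_natl mulnn.
Qed.

(** If [v (1 + U U^T) = 0], pairing with [v] gives [|v|^2 + |v U|^2 = 0], so [v = 0]. *)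
Lemma unitmx_1Dpsd X : psd X -> 1%:M + X \in unitmx.
Proof.
move=> [p [U ->]]; rewrite unitmxE unitfE; apply/negP => /det0P[v v0].
rewrite mulmxDr mulmx1 => H.
have : \tr (v *m v^T) + \tr ((v *m U) *m (v *m U)^T) = 0.
  rewrite -mxtraceD trmx_mul mulmxA -(mulmxA v U U^T) -mulmxDl H mul0mx.
  exact: mxtrace0.
have t1 : 0 <= \tr (v *m v^T).
  by rewrite trace_mul_tr; do 2 (apply: sumr_ge0 => ? _); exact: sqr_ge0.
have t2 : 0 <= \tr ((v *m U) *m (v *m U)^T).
  by rewrite trace_mul_tr; do 2 (apply: sumr_ge0 => ? _); exact: sqr_ge0.
move=> /eqP; rewrite paddr_eq0// => /andP[/eqP/trace_mul_tr_eq0 v00 _].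
by rewrite v00 eqxx in v0.
Qed.

End PSD.

(** * Brackets as families of matrices *)

Section Families.
Variables (R : realType) (m : nat).
Implicit Types (A : 'I_m -> 'M[R]_m) (X Y h k P : 'M[R]_m) (mu : bracket R m).

(* A bracket is handled through its right multiplications: rmul mu c is the
   matrix of v |-> mu(v, e_c). *)
Definition rmul mu : 'I_m -> 'M[R]_m := fun c => \matrix_(k, b) mu b c k 0.

(** The entry [A c i b] is component [i] of [mu(e_b, e_c)], so swapping [b] and [c] expresses
    skew-symmetry of the bracket. *)
Definition skewf A := forall c b i, A c i b = - A b i c.

(* For k = h^-1 these are the right multiplications of h . mu, if A are those of mu. *)
Definition act h k A : 'I_m -> 'M[R]_m :=
  fun c => \sum_d k d c *: (h *m A d *m k).

(** The factor 1/2 reduces the sum over all ordered pairs to pairs [i < j]: for a skew bracket this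
    is [Pmat]. *)
Definition gram A : 'M[R]_m := 2^-1 *: \sum_c A c *m (A c)^T.

(* mu (X /\ Y) mu^* in terms of the right multiplications of mu. *)
Definition Bform A X Y : 'M[R]_m :=
  2^-1 *: \sum_c \sum_d Y c d *: (A c *m X *m (A d)^T).

(** The right multiplications of [- pi(P) mu] when [A] are those of [mu]; [P] is left free so that
    the gauge equations can be treated apart from the nonlinearity. *)
Definition flowf P A : 'I_m -> 'M[R]_m :=
  fun c => - (P *m A c) + A c *m P + \sum_d P d c *: A d.

Lemma rmul_flow_rhs mu c : rmul (flow_rhs mu) c = flowf (Pmat mu) (rmul mu) c.
Proof.
apply/matrixP => k b; rewrite [LHS]mxE /flow_rhs /pi_act /flowf !mxE.
set P := Pmat mu.
have e1 : bapp mu (P *m evec R b) (evec R c) k 0 = \sum_j rmul mu c k j * P j b.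
  rewrite /bapp summxE; apply: eq_bigr => i _; rewrite summxE (bigD1 c)//= big1.
    rewrite addr0 !mxE eqxx mulr1 mulrC; congr (_ * _).
    rewrite (bigD1 b)//= big1; first by rewrite !mxE !eqxx mulr1 addr0.
    by move=> l lb; rewrite !mxE (negbTE lb) mulr0.
  by move=> l lc; rewrite !mxE (negbTE lc) mulr0 mul0r.
have e2 : bapp mu (evec R b) (P *m evec R c) k 0 = (\sum_d P d c *: rmul mu d) k b.
  rewrite /bapp !summxE (bigD1 b)//= [X in _ + X]big1 ?addr0.
    rewrite summxE; apply: eq_bigr => i _; rewrite !mxE !eqxx mul1r; congr (_ * _).
    rewrite (bigD1 c)//= big1; first by rewrite !mxE !eqxx mulr1 addr0.
    by move=> l lb; rewrite !mxE (negbTE lb) mulr0.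
  move=> l lb; rewrite summxE big1// => i _.
  by rewrite !mxE (negbTE lb) !mul0r.
rewrite e1 e2 summxE !opprD !opprK; congr (- _ + _ + _).
by apply: eq_bigr => j _; rewrite !mxE.
Qed.

Lemma rmul_inj mu nu : (forall c, rmul mu c = rmul nu c) -> forall i j, mu i j = nu i j.
Proof.
move=> H i j; apply/matrixP => k l; rewrite ord1.
by have /matrixP/(_ k i) := H j; rewrite !mxE.
Qed.

Lemma skewf_rmul mu : skew_bracket mu -> skewf (rmul mu).
Proof. by move=> H c b i; rewrite !mxE H mxE. Qed.

Lemma skew_bracket_rmul mu : skewf (rmul mu) -> skew_bracket mu.
Proof.
move=> H i j; apply/matrixP => k l; rewrite ord1.
by have := H j i k; rewrite !mxE.
Qed.

Lemma skewf_act h k A : skewf A -> skewf (act h k A).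
Proof.
move=> sA c b i; rewrite /act !summxE.
(* In this expansion, exchanging [x] with [y] amounts to renaming [d] and [l], and skewness of [A]
   supplies the sign. *)
have E (x y : 'I_m) : \sum_d (k d x *: (h *m A d *m k)) i y =
    \sum_d \sum_l \sum_j k d x * k l y * (h i j * A d j l).
  apply: eq_bigr => d _; rewrite !mxE mulr_sumr; apply: eq_bigr => l _.
  rewrite !mxE mulr_suml mulr_sumr; apply: eq_bigr => j _; ring.
rewrite !E exchange_big -sumrN /=; apply: eq_bigr => d _.
rewrite -sumrN; apply: eq_bigr => l _; rewrite -sumrN; apply: eq_bigr => j _.
by rewrite (sA l d); ring.
Qed.

Lemma sum_lt_sym (F : 'I_m -> 'I_m -> R) :
  (forall i, F i i = 0) -> (forall i j, F i j = F j i) ->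
  \sum_(i < m) \sum_(j < m | (i < j)%N) F i j = 2^-1 * \sum_i \sum_j F i j.
Proof.
move=> F0 Fs.
have -> : \sum_i \sum_j F i j =
   \sum_(i < m) \sum_(j < m | (i < j)%N) F i j + \sum_(i < m) \sum_(j < m | (j < i)%N) F i j.
  rewrite -big_split /=; apply: eq_bigr => i _.
  rewrite (bigID (fun j : 'I_m => (i < j)%N))/=; congr (_ + _).
  rewrite (bigID (fun j : 'I_m => (j < i)%N))/= [X in _ + X]big1 ?addr0.
    by apply: eq_bigl => j; rewrite -leqNgt andb_idl// => /ltnW.
  move=> j; rewrite -!leqNgt => /andP[h1 h2].
  by have -> : i = j by apply/val_inj/eqP; rewrite eqn_leq h1 h2.
rewrite [X in _ + X](exchange_big_dep xpredT)//=.
rewrite (eq_bigr (fun i : 'I_m => \sum_(j < m | (i < j)%N) F i j) (fun i _ => eq_bigr _ (fun j _ => Fs j i))).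
by lra.
Qed.

Lemma Pmat_gram mu : skew_bracket mu -> Pmat mu = gram (rmul mu).
Proof.
move=> sk; apply/matrixP => k l; rewrite /Pmat !mxE summxE.
under eq_bigr => i _ do rewrite summxE.
rewrite (@sum_lt_sym (fun i j => (mu i j *m (mu i j)^T) k l)).
- congr (_ * _); rewrite summxE exchange_big /=; apply: eq_bigr => c _.
  rewrite mxE; apply: eq_bigr => b _; rewrite mxE big_ord1 !mxE//.
- move=> i; have /eqP : mu i i = - mu i i by exact: sk.
  rewrite -subr_eq0 opprK -mulr2n -scaler_nat scaler_eq0 pnatr_eq0/= => /eqP ->.
  by rewrite mul0mx mxE.
by move=> i j; rewrite (sk j i) linearN/= mulNmx mulmxN opprK.
Qed.

Lemma bnorm2_trace mu : bnorm2 mu = \tr (Pmat mu).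
Proof.
rewrite /bnorm2 /Pmat raddf_sum; apply: eq_bigr => i _.
rewrite raddf_sum; apply: eq_bigr => j _.
rewrite /= mxtrace_mulC /mxtrace big_ord1 mxE /dotv.
by apply: eq_bigr => k _; rewrite mxE.
Qed.

(** Summing over [c] contracts [k d c] with [k e c] to an entry of [k k^T], so between the outer
    factors [h] only the inverse metric appears. *)
Lemma gram_act h k A :
  gram (act h k A) = h *m Bform A (k *m k^T) (k *m k^T) *m h^T.
Proof.
rewrite /gram /Bform -scalemxAr -scalemxAl; congr (_ *: _).
rewrite mulmx_sumr mulmx_suml.
under [RHS]eq_bigr => d _.
  rewrite mulmx_sumr mulmx_suml.
  under eq_bigr => e _.
    rewrite -scalemxAr -scalemxAl mxE.
    rewrite scaler_suml.
    over.
  rewrite exchange_big.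
  over.
rewrite [RHS]exchange_big /=; apply: eq_bigr => c _.
rewrite /act mulmx_suml; apply: eq_bigr => d _.
rewrite raddf_sum mulmx_sumr; apply: eq_bigr => e _ /=.
rewrite linearZ/= -scalemxAl -scalemxAr scalerA !mxE !trmx_mul !mulmxA.
by [].
Qed.

Lemma act_inv h k A c : h *m k = 1%:M -> act h k (act k h A) c = A c.
Proof.
move=> hk; rewrite /act.
under eq_bigr => d _.
  rewrite mulmx_sumr mulmx_suml scaler_sumr.
  under eq_bigr => e _.
    rewrite -scalemxAr -scalemxAl scalerA.
    rewrite !mulmxA hk mul1mx -mulmxA hk mulmx1.
    over.
  over.
rewrite exchange_big /= (bigD1 c)//= [X in _ + X]big1 ?addr0.
  rewrite -scaler_suml.
  have /matrixP/(_ c c) := hk; rewrite !mxE eqxx.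
  by under eq_bigr do rewrite mulrC; move=> ->; rewrite scale1r.
move=> e ec; rewrite -scaler_suml.
have /matrixP/(_ e c) := hk; rewrite !mxE (negbTE ec).
by under eq_bigr do rewrite mulrC; move=> ->; rewrite scale0r.
Qed.

Lemma Bform_entry A X Y (k l : 'I_m) : Bform A X Y k l =
  2^-1 * \sum_c \sum_d \sum_a \sum_b Y c d * X a b * (A c k a * A d l b).
Proof.
rewrite /Bform mxE summxE; congr (_ * _).
apply: eq_bigr => c _; rewrite summxE; apply: eq_bigr => d _.
rewrite !mxE mulr_sumr [RHS]exchange_big; apply: eq_bigr => b _ /=.
rewrite !mxE mulr_suml mulr_sumr; apply: eq_bigr => a _; ring.
Qed.

(** Skewness is applied to both copies of [A], which exchanges the two input slots; the two signs
    cancel. *)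
Lemma Bform_sym A X Y : skewf A -> Bform A X Y = Bform A Y X.
Proof.
move=> sA; apply/matrixP => k l; rewrite !Bform_entry; congr (_ * _).
under eq_bigr do rewrite exchange_big /=.
rewrite exchange_big /=; apply: eq_bigr => a _.
under eq_bigr do rewrite exchange_big /=.
rewrite exchange_big /=; apply: eq_bigr => b _.
apply: eq_bigr => c _; apply: eq_bigr => d _.
by rewrite (sA a c k) (sA b d l); ring.
Qed.

Lemma BformDl A X1 X2 Y : Bform A (X1 + X2) Y = Bform A X1 Y + Bform A X2 Y.
Proof.
rewrite /Bform -scalerDr; congr (_ *: _); rewrite -big_split; apply: eq_bigr => c _ /=.
by rewrite -big_split; apply: eq_bigr => d _ /=; rewrite mulmxDr mulmxDl scalerDr.
Qed.

Lemma BformNl A X Y : Bform A (- X) Y = - Bform A X Y.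
Proof.
rewrite /Bform -scalerN; congr (_ *: _); rewrite -sumrN; apply: eq_bigr => c _ /=.
by rewrite -sumrN; apply: eq_bigr => d _ /=; rewrite mulmxN mulNmx scalerN.
Qed.

(** Difference of squares for a symmetric bilinear map; it linearizes the quadratic equation in
    [Hsol_unique]. *)
Lemma Bform_subsqr A X Y : skewf A ->
  Bform A X X - Bform A Y Y = Bform A (X - Y) (X + Y).
Proof.
move=> sA; rewrite BformDl BformNl !(Bform_sym _ (X + Y))// !BformDl.
by rewrite (Bform_sym X Y)// opprD addrA addrK.
Qed.

(** For [X = U U^T] and [Y = V V^T], each column [v] of [V] contributes [W W^T / 2] with
    [W = mu(., v) U]. *)
Lemma psd_Bform A X Y : psd X -> psd Y -> psd (Bform A X Y).
Proof.
move=> [p [U ->]] [q [V ->]].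
have -> : Bform A (U *m U^T) (V *m V^T) =
    2^-1 *: \sum_l (\sum_c V c l *: (A c *m U)) *m (\sum_c V c l *: (A c *m U))^T.
  rewrite /Bform; congr (_ *: _).
  under [RHS]eq_bigr => l _.
    rewrite mulmx_suml.
    under eq_bigr => c _.
      rewrite raddf_sum mulmx_sumr.
      under eq_bigr => d _ do rewrite /= linearZ/= -scalemxAl -scalemxAr scalerA trmx_mul.
      over.
    over.
  rewrite [RHS]exchange_big; apply: eq_bigr => c _ /=.
  rewrite [RHS]exchange_big; apply: eq_bigr => d _ /=.
  rewrite -scaler_suml !mulmxA; congr (_ *: _).
  by rewrite mxE; apply: eq_bigr => l _; rewrite mxE.
apply: psdZ; first by rewrite invr_ge0.
apply: psd_sum => l _; by eexists; eexists.
Qed.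

(* Zm A j X: the columns of X lie in the j-th term of the upper central series. *)
Fixpoint Zm A j X := if j is j'.+1 then forall c, Zm A j' (A c *m X) else X = 0.

Lemma Zm0 A j : Zm A j 0.
Proof. by elim: j => //= j IH c; rewrite mulmx0. Qed.

Lemma ZmD A j X Y : Zm A j X -> Zm A j Y -> Zm A j (X + Y).
Proof.
elim: j X Y => [|j IH] X Y /=; first by move=> -> ->; rewrite addr0.
by move=> hX hY c; rewrite mulmxDr; exact: IH.
Qed.

Lemma ZmZ A j a X : Zm A j X -> Zm A j (a *: X).
Proof.
elim: j X => [|j IH] X /=; first by move=> ->; rewrite scaler0.
by move=> hX c; rewrite -scalemxAr; exact: IH.
Qed.

Lemma Zm_sum A j (I : Type) (r : seq I) (F : I -> 'M[R]_m) :
  (forall i, Zm A j (F i)) -> Zm A j (\sum_(i <- r) F i).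
Proof. by move=> H; apply: big_ind => //; [exact: Zm0|exact: ZmD]. Qed.

Lemma Zm_mulr A j X Y : Zm A j X -> Zm A j (X *m Y).
Proof.
elim: j X => [|j IH] X /=; first by move=> ->; rewrite mul0mx.
by move=> hX c; rewrite mulmxA; exact: IH.
Qed.

Lemma Zm_Bform A j X Y : Zm A j.+1 X -> Zm A j (Bform A X Y).
Proof.
move=> hX; apply: ZmZ; apply: Zm_sum => c; apply: Zm_sum => d; apply: ZmZ.
exact/Zm_mulr/hX.
Qed.

Lemma bapp_evec mu v c : bapp mu v (evec R c) = rmul mu c *m v.
Proof.
apply/matrixP => k l; rewrite ord1 /bapp summxE mxE; apply: eq_bigr => i _.
rewrite summxE (bigD1 c)//= big1 ?addr0.
  by rewrite !mxE eqxx mulr1 mulrC.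
by move=> j jc; rewrite !mxE (negbTE jc) mulr0 mul0r.
Qed.

Lemma lnested_eq mu v v' i : (forall l, (l <= i)%N -> v l = v' l) ->
  lnested mu v i = lnested mu v' i.
Proof.
elim: i => [|i IH] H /=; first exact: H.
by rewrite IH ?H// => l li; apply: H; exact: leqW.
Qed.

(** The hypothesis speaks of iterated brackets, that is, of the lower central series, whereas the
    argument runs along the upper one. *)
Lemma nilpotent_Zm mu : nilpotent_bracket mu ->
  exists K, forall X, Zm (rmul mu) K X.
Proof.
move=> [K HK]; exists K => X.
(* Generalization for the induction: if the columns of [Y] are brackets nested [i] deep, the
   remaining [j = K - i] steps annihilate [Y]. *)
suff H j i (Y : 'M[R]_m) (V : 'I_m -> nat -> 'cV[R]_m) : (i + j = K)%N ->
    (forall b, col b Y = lnested mu (V b) i) -> Zm (rmul mu) j Y.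
  by apply: (H K 0%N X (fun b _ => col b X)).
elim: j i Y V => [|j IH] i Y V /= e HY.
  apply/matrixP => k b; have /matrixP/(_ k 0) := HY b.
  by rewrite -(addn0 i) e HK !mxE.
(* Multiplying by [A c] appends [e_c] to each sequence and leaves its values up to [i] unchanged. *)
move=> c; apply: (IH i.+1 _ (fun b l => if (l <= i)%N then V b l else evec R c)).
  by rewrite -e addnS.
move=> b /=; rewrite ltnn bapp_evec.
rewrite (@lnested_eq _ _ (V b)); last by move=> l ->.
by rewrite -HY !colE mulmxA.
Qed.

Lemma gram_trace_eq0 (A : 'I_m -> 'M[R]_m) : \tr (gram A) = 0 -> forall c, A c = 0.
Proof.
rewrite /gram mxtraceZ raddf_sum /= => /eqP.
rewrite mulf_eq0 invr_eq0 pnatr_eq0 /= => /eqP H c.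
apply: trace_mul_tr_eq0; apply: (psumr_eq0P _ H) => // d _.
by apply: psd_trace_ge0; exists m, (A d).
Qed.

Lemma Pmat_sym (mu : bracket R m) : (Pmat mu)^T = Pmat mu.
Proof.
rewrite /Pmat !raddf_sum /=; apply: eq_bigr => i _; rewrite raddf_sum /=.
by apply: eq_bigr => j _; rewrite trmx_mul trmxK.
Qed.

Lemma act1 (A : 'I_m -> 'M[R]_m) c : act 1%:M 1%:M A c = A c.
Proof.
rewrite /act (bigD1 c)//= big1 ?addr0.
  by rewrite mxE eqxx scale1r mul1mx mulmx1.
by move=> d dc; rewrite mxE (negbTE dc) scale0r.
Qed.

Lemma bnorm2_ge0 (mu : bracket R m) : 0 <= bnorm2 mu.
Proof.
by do 2 (apply: sumr_ge0 => ? _); apply: sumr_ge0 => ? _; rewrite -expr2 sqr_ge0.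
Qed.

End Families.

(** * The polynomial solution of the inverse metric equation *)

Section Gauge.
Variables (R : realType) (m : nat).
Implicit Types (A : 'I_m -> 'M[R]_m) (h k P : R -> 'M[R]_m).

(** Product rule: [h'] yields [- P A], the factor [k] on the right yields [A P], and the coefficient
    [k d c] yields the sum over [P d c]. Here [P] is arbitrary. *)
Lemma mc1_act A h k P : mc1 h (fun t => - (P t *m h t)) ->
  mc1 k (fun t => k t *m P t) ->
  forall c, mc1 (fun t => act (h t) (k t) A c)
                (fun t => flowf (P t) (act (h t) (k t) A) c).
Proof.
move=> dh dk c.
have H d := mc1Z (dk d c) (mc1M (mc1M dh (mc1_cst (A d))) dk).
apply: (mc1_eq (mc1_sum H)) => t _.
rewrite /flowf /act mulmx_sumr mulmx_suml -sumrN -big_split /=.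
under [X in _ = _ + X]eq_bigr do rewrite scaler_sumr.
rewrite [X in _ = _ + X]exchange_big -big_split /=; apply: eq_bigr => d _.
rewrite mulmx0 addr0 -scalemxAl -scalemxAr addrC scalerDr !mulNmx scalerN !mulmxA.
congr (_ + _); rewrite mxE scaler_suml; apply: eq_bigr => e _.
by rewrite scalerA mulrC.
Qed.

(** Undoing the gauge freezes the flow: the product rule terms cancel. *)
Lemma act_conserved (A : R -> 'I_m -> 'M[R]_m) h k P :
  mc1 h (fun t => - (P t *m h t)) -> mc1 k (fun t => k t *m P t) ->
  (forall c, mc1 (A^~ c) (fun t => flowf (P t) (A t) c)) ->
  forall c t, 0 <= t -> act (k t) (h t) (A t) c = act (k 0) (h 0) (A 0) c.
Proof.
move=> dh dk dA c t t0.
have H d := mc1Z (dh d c) (mc1M (mc1M dk (dA d)) dh).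
apply: (mc1_const (mc1_sum H) t0) => s _.
rewrite big_split /=.
(* The terms with [P] on either side of [A] cancel; what is left is offset by the derivative of the
   coefficient [h d c]. *)
have E d : (k s *m P s *m A s d + k s *m flowf (P s) (A s) d) *m h s +
    k s *m A s d *m - (P s *m h s) = \sum_e P s e d *: (k s *m A s e *m h s).
  rewrite /flowf !mulmxDr !mulmxDl !mulmxN !mulNmx !mulmxA.
  rewrite !addrA subrr add0r addrAC subrr add0r.
  by rewrite mulmx_sumr mulmx_suml; apply: eq_bigr => e _; rewrite -scalemxAr -scalemxAl.
under [X in _ + X]eq_bigr do rewrite E scaler_sumr.
rewrite [X in _ + X]exchange_big -big_split /= big1// => d _.
rewrite !mxE scaleNr scaler_suml addrC; apply/eqP; rewrite subr_eq0; apply/eqP.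
by apply: eq_bigr => e _; rewrite scalerA mulrC.
Qed.

(** Being at level [j] is a linear condition with coefficients constant in time, so it passes from
    the derivative to the function; at level 0 a zero derivative preserves the initial value 0. *)
Lemma Zm_primitive A j (D D' : R -> 'M[R]_m) : mc1 D D' -> D 0 = 0 ->
  (forall t, 0 < t -> Zm A j (D' t)) -> forall t, 0 <= t -> Zm A j (D t).
Proof.
elim: j D D' => [|j IH] D D' dD D0 H t t0 /=.
  by rewrite (mc1_const dD t0)// => s /andP[s0 _]; exact: H.
move=> c; apply: (IH (fun t => A c *m D t) (fun t => A c *m D' t)) => //.
- by apply: (mc1_eq (mc1M (mc1_cst (A c)) dD)) => s _; rewrite mul0mx add0r.
- by rewrite D0 mulmx0.
by move=> s s0; exact: H.
Qed.

End Gauge.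

(** * Power series coefficients of the inverse metric *)

Section PolynomialSolution.
Variables (R : realType) (m : nat) (A : 'I_m -> 'M[R]_m) (K : nat).
Hypotheses (skA : skewf A) (nilA : forall X, Zm A K X).

(* Course-of-values recursion: Hfun n k is the k-th coefficient only for k <= n. *)
Fixpoint Hfun (n : nat) : nat -> 'M[R]_m :=
  if n is n'.+1 then
    fun k => if (k <= n')%N then Hfun n' k else
      (2 / n'.+1%:R) *: \sum_(i < n'.+1) Bform A (Hfun n' i) (Hfun n' (n' - i)%N)
  else fun=> 1%:M.

Definition Hcoef k := Hfun k k.

Lemma HfunE n k : (k <= n)%N -> Hfun n k = Hcoef k.
Proof.
elim: n => [|n IH]; first by rewrite leqn0 => /eqP ->.
rewrite leq_eqVlt => /predU1P[->//|kn].
by rewrite /= -ltnS kn IH.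
Qed.

Lemma HcoefS k : Hcoef k.+1 =
  (2 / k.+1%:R) *: \sum_(i < k.+1) Bform A (Hcoef i) (Hcoef (k - i)).
Proof.
rewrite {1}/Hcoef /= ltnn; congr (_ *: _); apply: eq_bigr => i _.
by rewrite !HfunE// ?leq_subr// -ltnS.
Qed.

Lemma psd_Hcoef k : psd (Hcoef k).
Proof.
have [n] := ubnP k; elim: n k => // n IH [|k] kn; first exact: psd1.
rewrite HcoefS; apply: psdZ; first by rewrite divr_ge0.
apply: psd_sum => i _; apply: psd_Bform; apply: IH.
  by rewrite (leq_trans (ltn_ord i)).
by rewrite (leq_ltn_trans (leq_subr _ _)).
Qed.

(** In [B(H_i, H_(k-i))] the indices add up to [k], so one of them has already reached the previous
    threshold; [Bform] lowers the level of that argument by one, in either slot by symmetry. The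
    thresholds therefore double at each step. *)
Lemma Zm_Hcoef j k : (j <= K)%N -> (2 ^ j <= k.+1)%N -> Zm A (K - j) (Hcoef k).
Proof.
elim: j k => [|j IH] k jK; first by rewrite subn0.
case: k => [|k]; first by rewrite expnS; have := expn_gt0 2 j; lia.
rewrite expnS => kj; rewrite HcoefS; apply/ZmZ/Zm_sum => i.
have E : (K - j)%N = (K - j.+1).+1 by lia.
have [ij|ij] := leqP (2 ^ j) i.+1.
  by apply: Zm_Bform; rewrite -E; apply: IH => //; exact: ltnW.
rewrite Bform_sym//; apply: Zm_Bform; rewrite -E; apply: IH; first exact: ltnW.
have := ltn_ord i; lia.
Qed.

(** Level 0 is reached after [K] doublings, so [H_k = 0] once [k + 1 >= 2^K]. *)
Definition Hdeg := (2 ^ K)%N.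

Lemma Hcoef_eq0 k : (Hdeg <= k.+1)%N -> Hcoef k = 0.
Proof. by move=> /(Zm_Hcoef (leqnn K)); rewrite subnn. Qed.

Definition Hpoly : 'M[{poly R}]_m :=
  \matrix_(a, b) \poly_(k < Hdeg) Hcoef k a b.

Lemma coef_Hpoly a b k : (Hpoly a b)`_k = Hcoef k a b.
Proof.
rewrite mxE coef_poly; case: ltnP => // Hk.
by rewrite Hcoef_eq0 ?mxE//; exact: leqW.
Qed.

Definition evmx (M : 'M[{poly R}]_m) (t : R) : 'M[R]_m := map_mx (horner_eval t) M.

Definition dmx (M : 'M[{poly R}]_m) : 'M[{poly R}]_m := map_mx (@deriv R) M.

Lemma mc1_evmx M : mc1 (evmx M) (evmx (dmx M)).
Proof.
move=> i j; under eq_fun do rewrite mxE.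
by apply: (c1_eq (c1_horner _)) => t _; rewrite !mxE.
Qed.

(** For [t >= 0] the powers of [t] are nonnegative weights on the coefficient matrices [C i]. *)
Lemma psd_evmx (M : 'M[{poly R}]_m) (C : nat -> 'M[R]_m) (t : R) : 0 <= t ->
  (forall i, psd (C i)) -> (forall a b i, (M a b)`_i = C i a b) -> psd (evmx M t).
Proof.
move=> t0 pC MC; pose N := (\sum_a \sum_b size (M a b))%N.
have -> : evmx M t = \sum_(i < N) t ^+ i *: C i.
  apply/matrixP => a b; rewrite mxE summxE /horner_eval (@horner_coef_wide _ N).
    by apply: eq_bigr => i _; rewrite mxE MC mulrC.
  by rewrite /N (bigD1 a)//= (bigD1 b)//= -addnA leq_addr.
by apply: psd_sum => i _; apply: psdZ => //; exact: exprn_ge0.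
Qed.

Definition Hsol := evmx Hpoly.
Definition dHsol := evmx (dmx Hpoly).
Definition ddHsol := evmx (dmx (dmx Hpoly)).

Lemma Hsol0 : Hsol 0 = 1%:M.
Proof.
apply/matrixP => a b; rewrite mxE /horner_eval horner_coef0 coef_Hpoly.
by rewrite /Hcoef.
Qed.

Lemma psd_dHsol (t : R) : 0 <= t -> psd (dHsol t).
Proof.
move=> t0; apply: (psd_evmx (C := fun i => i.+1%:R *: Hcoef i.+1) t0) => [i|a b i].
  by apply: psdZ => //; exact: psd_Hcoef.
by rewrite mxE coef_deriv coef_Hpoly mxE mulr_natl.
Qed.

Lemma psd_ddHsol (t : R) : 0 <= t -> psd (ddHsol t).
Proof.
move=> t0; apply: (psd_evmx (C := fun i => (i.+1 * i.+2)%:R *: Hcoef i.+2) t0) => [i|a b i].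
  by apply: psdZ => //; exact: psd_Hcoef.
by rewrite mxE coef_deriv mxE coef_deriv coef_Hpoly mxE mulr_natl -mulrnA mulnC.
Qed.

(** Subtracting 1 removes the coefficient [H_0 = 1] and leaves positive semidefinite ones;
    invertibility of [H] follows from this. *)
Lemma psd_Hsol_sub1 (t : R) : 0 <= t -> psd (Hsol t - 1%:M).
Proof.
move=> t0; rewrite (_ : _ - _ = evmx (Hpoly - 1%:M) t); last first.
  rewrite /evmx map_mxB map_scalar_mx /=; congr (_ - _%:M).
  by rewrite /horner_eval hornerC.
apply: (psd_evmx (C := fun i => if i == 0%N then 0 else Hcoef i) t0) => [[|i]|a b i].
- exact: psd0.
- exact: psd_Hcoef.
have -> : (Hpoly - 1%:M) a b = Hpoly a b - (a == b)%:R.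
  by move: Hpoly => M; rewrite !mxE.
rewrite coefB coef_Hpoly coefMn coef1; case: i => [|i] /=.
  by rewrite !mxE subrr.
by rewrite mul0rn subr0.
Qed.

(** The coefficient of [t^i] is [(Hdeg - i) H_i], and [H_i] vanishes whenever the factor is
    negative. *)
Lemma psd_deg_Hsol (t : R) : 0 <= t -> psd (Hdeg%:R *: Hsol t - t *: dHsol t).
Proof.
move=> t0.
rewrite (_ : _ - _ = evmx (Hdeg%:R%:P *: Hpoly - 'X *: dmx Hpoly) t); last first.
  apply/matrixP => a b; rewrite !mxE /horner_eval !hornerE.
  by [].
apply: (psd_evmx (C := fun i => (Hdeg%:R - i%:R) *: Hcoef i) t0) => [i|a b i].
  have [Hi|Hi] := leqP i Hdeg.
    by apply: psdZ; [rewrite subr_ge0 ler_nat|exact: psd_Hcoef].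
  by rewrite Hcoef_eq0 ?scaler0; [exact: psd0|lia].
have -> : (Hdeg%:R%:P *: Hpoly - 'X *: dmx Hpoly) a b =
    Hdeg%:R%:P * Hpoly a b - 'X * dmx Hpoly a b.
  by move: Hpoly (dmx Hpoly) => M N; rewrite !mxE.
rewrite coefB coefCM coefXM.
rewrite coef_Hpoly [RHS]mxE mulrBl; congr (_ - _).
case: i => [|i] /=; first by rewrite mul0r.
by rewrite mxE coef_deriv coef_Hpoly mulr_natl.
Qed.

(** The recursion for the coefficients is an identity of polynomials in each entry, which is then
    evaluated at [t]. *)
Lemma dHsolE (t : R) : dHsol t = 2 *: Bform A (Hsol t) (Hsol t).
Proof.
apply/matrixP => k l; rewrite mxE [RHS]mxE Bform_entry mulrA divff ?mul1r; last first.
  by rewrite pnatr_eq0.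
have -> : dmx Hpoly k l = \sum_c \sum_d \sum_a \sum_b
    (A c k a * A d l b) *: (Hpoly c d * Hpoly a b).
  apply/polyP => n; rewrite mxE coef_deriv coef_Hpoly HcoefS mxE summxE.
  have n0 : n.+1%:R != 0 :> R by rewrite pnatr_eq0.
  rewrite -[LHS]mulr_natl mulrA (_ : n.+1%:R * (2 / n.+1%:R) = 2 :> R); last by field.
  rewrite mulr_sumr.
  under eq_bigr do rewrite Bform_entry mulrA divff ?mul1r ?pnatr_eq0//.
  rewrite exchange_big coef_sum /=; apply: eq_bigr => c _.
  rewrite exchange_big coef_sum /=; apply: eq_bigr => d _.
  rewrite exchange_big coef_sum /=; apply: eq_bigr => a _.
  rewrite exchange_big coef_sum /=; apply: eq_bigr => b _.
  rewrite coefZ coefMr mulr_sumr; apply: eq_bigr => i _.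
  by rewrite !coef_Hpoly mulrC.
have HE a b : Hsol t a b = (Hpoly a b).[t] by rewrite mxE.
rewrite /horner_eval.
do 4 (rewrite horner_sum; apply: eq_bigr => ? _).
by rewrite hornerZ hornerM !HE mulrC.
Qed.

Lemma mc1_Hsol : mc1 Hsol (fun t => 2 *: Bform A (Hsol t) (Hsol t)).
Proof. by apply: (mc1_eq (mc1_evmx Hpoly)) => t _; rewrite -dHsolE. Qed.

(** The difference solves the linear equation [D' = 2 B(D, X + H)]. If [D] is at level [j + 1], then
    [D'], and hence [D], is at level [j]; after [K] steps [D = 0]. *)
Lemma Hsol_unique (X : R -> 'M[R]_m) :
  mc1 X (fun t => 2 *: Bform A (X t) (X t)) -> X 0 = 1%:M ->
  forall t, 0 <= t -> X t = Hsol t.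
Proof.
move=> dX X0.
pose D t := X t - Hsol t.
have dD : mc1 D (fun t => 2 *: Bform A (D t) (X t + Hsol t)).
  apply: (mc1_eq (mc1D dX (mc1N mc1_Hsol))) => t _.
  by rewrite -scalerBr Bform_subsqr.
have ZD j : (j <= K)%N -> forall t, 0 <= t -> Zm A (K - j) (D t).
  elim: j => [|j IH] jK t t0; first by rewrite subn0.
  apply: (Zm_primitive dD _ _ t0); first by rewrite /D X0 Hsol0 subrr.
  move=> s s0; apply/ZmZ/Zm_Bform.
  by rewrite subnSK//; apply: IH; [exact: ltnW|exact: ltW].
move=> t t0; have := ZD K (leqnn K) t t0; rewrite subnn /= /D.
by move/eqP; rewrite subr_eq0 => /eqP.
Qed.

Lemma Hsol_unit (t : R) : 0 <= t -> Hsol t \in unitmx.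
Proof. by move=> /psd_Hsol_sub1/unitmx_1Dpsd; rewrite addrC subrK. Qed.

Definition Hinv (t : R) := invmx (Hsol (Num.max t 0)).

Lemma continuous_evmx M i j : continuous (fun t : R => evmx M (Num.max t 0) i j).
Proof.
under eq_fun do rewrite mxE.
exact: (continuous_max0 (@continuous_horner R (M i j))).
Qed.

(** Cramer's rule: the inverse is the adjugate over the determinant, and both are polynomial in
    [t]. *)
Lemma continuous_Hinv i j : continuous (fun t => Hinv t i j).
Proof.
have E : (fun t => Hinv t i j) = (fun t =>
    ((\det Hpoly).[Num.max t 0])^-1 * evmx (\adj Hpoly) (Num.max t 0) i j).
  apply/funext => t; rewrite /Hinv /invmx Hsol_unit ?le_max ?lexx ?orbT// mxE.
  by rewrite /Hsol /evmx det_map_mx map_mx_adj.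
rewrite E => t; apply: cvgM; last exact: continuous_evmx.
apply: cvgV; last exact: (continuous_max0 (@continuous_horner R (\det Hpoly))).
have : 0 <= Num.max t 0 by rewrite le_max lexx orbT.
by move=> /Hsol_unit; rewrite unitmxE unitfE /Hsol /evmx det_map_mx.
Qed.

End PolynomialSolution.

(** * The bracket flow *)

Section Flow.
Variables (R : realType) (m : nat) (mu0 : bracket R m) (K : nat).
Hypotheses (sk0 : skew_bracket mu0) (nil0 : forall X, Zm (rmul mu0) K X).

Let skA := skewf_rmul sk0.
Local Notation Hsol := (Hsol (rmul mu0) K).
Local Notation dHsol := (dHsol (rmul mu0) K).
Local Notation ddHsol := (ddHsol (rmul mu0) K).
Local Notation Hinv := (Hinv (rmul mu0) K).

Lemma Hsol_sym (t : R) : 0 <= t -> (Hsol t)^T = Hsol t.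
Proof.
move=> t0; have := psd_sym (psd_Hsol_sub1 skA nil0 t0).
by rewrite linearB/= tr_scalar_mx => /addIr.
Qed.

(** From [k k^T = H] and [P = h H' h^T / 2] one gets [k P = (H' H^-1 / 2) k], where the matrix in
    front of [k] is known: the nonlinear flow turns into a linear equation for [k]. *)
Lemma flow_exists : exists mu, bracket_flow_sol mu0 mu.
Proof.
pose M (t : R) := (2^-1 *: dHsol (Num.max t 0)) *m Hinv t.
have cM i j : continuous (fun t => M t i j).
  apply: continuous_mulmx_entry.
    move=> a b; under eq_fun do rewrite mxE.
    by move=> x; apply: cvgM; [exact: cvg_cst|exact: continuous_evmx].
  by move=> a b; exact: continuous_Hinv.
have [k [dk k0]] := linear_ode cM.
have [|h [dh h0]] := @linear_ode_r R m (fun t => - M t).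
  by move=> i j; under eq_fun do rewrite mxE; move=> x; apply: cvgN; exact: cM.
have hk t : 0 <= t -> h t *m k t = 1%:M.
  move=> t0; rewrite (mc1_const (mc1M dh dk) t0) ?h0 ?k0 ?mulmx1// => s _.
  by rewrite mulmxN mulNmx mulmxA addNr.
have MH s : 0 <= s -> M s *m Hsol s = 2^-1 *: dHsol s.
  move=> s0; rewrite /M /Hinv (max_idPl s0) -mulmxA mulVmx ?mulmx1//.
  exact: Hsol_unit.
(* The derivative of [h H h^T] is [(- 1/2 + 1 - 1/2) h H' h^T = 0]. *)
have hHh t : 0 <= t -> h t *m Hsol t *m (h t)^T = 1%:M.
  have dH : mc1 Hsol dHsol by exact: mc1_evmx.
  move=> t0; rewrite (mc1_const (mc1M (mc1M dh dH) (mc1_tr dh)) t0).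
    by rewrite Hsol0// h0 trmx1 !mulmx1.
  move=> s /andP[/ltW s0 _].
  rewrite trmx_mul [(- M s)^T]linearN/=.
  have HM : Hsol s *m (M s)^T = 2^-1 *: dHsol s.
    rewrite -[in LHS](Hsol_sym s0) -trmx_mul MH// linearZ/= psd_sym//.
    exact: psd_dHsol.
    have -> : h s *m - M s *m Hsol s = - (2^-1 *: (h s *m dHsol s)).
    by rewrite mulmxN mulNmx -mulmxA MH// -scalemxAr.
  have -> : h s *m Hsol s *m (- (M s)^T *m (h s)^T) =
      - (2^-1 *: (h s *m dHsol s *m (h s)^T)).
    by rewrite mulNmx mulmxN -(mulmxA (h s) (Hsol s)) (mulmxA (Hsol s)) HM -scalemxAl -scalemxAr mulmxA.
  rewrite mulmxDl mulNmx -scalemxAl.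
  set Z := _ *m dHsol s *m _.
  by rewrite addrAC -opprD -scalerDl (_ : 2^-1 + 2^-1 = 1 :> R) ?scale1r ?addNr//; lra.
have HhT t : 0 <= t -> Hsol t *m ((h t)^T *m h t) = 1%:M.
  by move=> t0; rewrite mulmxA; apply: mulmx1C; rewrite mulmxA hHh.
have HinvE t : 0 <= t -> Hinv t = (h t)^T *m h t.
  move=> t0; rewrite -[LHS]mulmx1 -(HhT t t0) (mulmxA (Hinv t)) /Hinv (max_idPl t0).
  by rewrite mulVmx ?mul1mx//; exact: Hsol_unit.
have kh t : 0 <= t -> k t *m h t = 1%:M by move=> t0; apply/mulmx1C/hk.
(* Because [H^-1 = h^T h], the equations for [h] and [k] take the gauge form with this [P]. *)
pose P t := 2^-1 *: (h t *m dHsol t *m (h t)^T).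
have dh' : mc1 h (fun t => - (P t *m h t)).
  apply: (mc1_eq dh) => t /ltW t0; rewrite mulmxN; congr (- _).
  by rewrite /M HinvE// /P (max_idPl t0) -!scalemxAl -scalemxAr !mulmxA.
have dk' : mc1 k (fun t => k t *m P t).
  apply: (mc1_eq dk) => t /ltW t0.
  rewrite /M HinvE// /P (max_idPl t0) -!scalemxAl -scalemxAr !mulmxA kh// mul1mx.
  by rewrite -!mulmxA hk// mulmx1.
pose mu (t : R) : bracket R m := fun i j => \col_l act (h t) (k t) (rmul mu0) j l i.
have rmulmu t c : rmul (mu t) c = act (h t) (k t) (rmul mu0) c.
  by apply/matrixP => a b; rewrite !mxE.
have dmu := mc1_act (rmul mu0) dh' dk'.
exists mu; split; last split.
- by apply: rmul_inj => c; rewrite rmulmu h0 k0 act1.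
- move=> i j l; apply: continuous_subspaceT.
  by under eq_fun do rewrite mxE; have [] := dmu j l i.
move=> t t0 i j l.
(* This closes the loop: since [k k^T = H], the auxiliary [P] is the endomorphism of the bracket
   just constructed. *)
have Pt : Pmat (mu t) = P t.
  have sk : skew_bracket (mu t).
    apply: skew_bracket_rmul => c b a; rewrite !rmulmu.
    exact: skewf_act.
  rewrite Pmat_gram// /gram; under eq_bigr do rewrite rmulmu.
  rewrite -/(gram _) gram_act.
  have -> : k t *m (k t)^T = Hsol t.
    transitivity (k t *m (h t *m Hsol t *m (h t)^T) *m (k t)^T).
      by rewrite hHh ?mulmx1// ltW.
    by rewrite !mulmxA kh ?ltW// mul1mx -mulmxA -trmx_mul kh ?ltW// trmx1 mulmx1.
  rewrite /P dHsolE//; move: (Bform _ _ _) => B; rewrite -!scalemxAr -!scalemxAl scalerA mulVf ?scale1r//.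
have := (dmu j l i).2 t t0.
have -> : (fun t => act (h t) (k t) (rmul mu0) j l i) = (fun s => mu s i j l 0).
  by apply/funext => s; rewrite mxE.
have -> : flowf (P t) (act (h t) (k t) (rmul mu0)) j l i = flow_rhs (mu t) i j l 0.
  transitivity (rmul (flow_rhs (mu t)) j l i); last by rewrite mxE.
  rewrite rmul_flow_rhs Pt /flowf rmulmu.
  by under [in RHS]eq_bigr do rewrite rmulmu.
move=> d; split; first exact: ex_derive.
by rewrite derive1E; exact: derive_val.
Qed.

(** * Gauge and norm bounds for an arbitrary solution *)

Variable nu : R -> bracket R m.
Hypothesis solnu : bracket_flow_sol mu0 nu.

Let P t := Pmat (nu (Num.max t 0)).

Lemma c1_flow i j l : c1 (fun t => nu (Num.max t 0) i j l 0)
  (fun t => flow_rhs (nu (Num.max t 0)) i j l 0).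
Proof.
have [_ [cnu dnu]] := solnu; split.
  exact: (continuous_within_max0 (cnu i j l)).
move=> t t0; have [d1 d2] := dnu t t0 i j l.
apply: (@near_eq_is_derive _ _ _ (fun t => nu t i j l 0)).
  near=> s; rewrite (_ : Num.max s 0 = s)//.
  by apply/max_idPl/ltW; near: s; exact: lt_nbhsr.
by rewrite (max_idPl (ltW t0)) -d2 derive1E; exact: derivableP.
Unshelve. all: by end_near.
Qed.

Lemma continuous_Pmat i j : continuous (fun t => P t i j).
Proof.
have E : (fun t => P t i j) = (fun t => \sum_(a < m) \sum_(b < m | (a < b)%N)
   nu (Num.max t 0) a b i 0 * nu (Num.max t 0) a b j 0).
  apply/funext => t; rewrite /P /Pmat summxE; apply: eq_bigr => a _.
  by rewrite summxE; apply: eq_bigr => b _; rewrite mxE big_ord1 !mxE.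
rewrite E; do 2 (apply: continuous_sum => ?).
by move=> x; apply: cvgM; exact: (c1_flow _ _ _).1.
Qed.

(** Along a given solution [P] is known, so [h] and [k] solve linear equations; [k k^T] then
    satisfies the initial value problem of [H], and uniqueness identifies the two. *)
Lemma flow_gauge : exists h : R -> 'M[R]_m,
  mc1 h (fun t => - (P t *m h t)) /\
  forall t, 0 <= t -> [/\ P t = 2^-1 *: (h t *m dHsol t *m (h t)^T),
    h t *m Hsol t *m (h t)^T = 1%:M &
    bnorm2 (nu t) = 0 -> forall i j, mu0 i j = 0].
Proof.
have [k [dk k0]] := linear_ode_r continuous_Pmat.
have [|h [dh' h0]] := @linear_ode R m (fun t => - P t).
  by move=> i j; under eq_fun do rewrite mxE; move=> x; apply: cvgN; exact: continuous_Pmat.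
have dh : mc1 h (fun t => - (P t *m h t)).
  by apply: (mc1_eq dh') => t _; rewrite mulNmx.
have kh t : 0 <= t -> k t *m h t = 1%:M.
  move=> t0; rewrite (mc1_const (mc1M dk dh) t0) ?h0 ?k0 ?mulmx1// => s _.
  by rewrite mulmxN mulmxA subrr.
have hk t : 0 <= t -> h t *m k t = 1%:M by move=> t0; apply/mulmx1C/kh.
pose A (t : R) := rmul (nu (Num.max t 0)).
have dA c : mc1 (A^~ c) (fun t => flowf (P t) (A t) c).
  move=> i j.
  have -> : (fun t => A t c i j) = (fun t => nu (Num.max t 0) j c i 0).
    by apply/funext => t; rewrite mxE.
  apply: (c1_eq (c1_flow _ _ _)) => t _.
  by have /matrixP/(_ i j) := rmul_flow_rhs (nu (Num.max t 0)) c; rewrite [X in X = _ -> _]mxE.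
have A0 c : A 0 c = rmul mu0 c.
  by apply/matrixP => i j; rewrite !mxE maxxx solnu.1.
have actA t c : 0 <= t -> act (k t) (h t) (A t) c = rmul mu0 c.
  move=> t0; rewrite (act_conserved dh dk dA)// h0 k0 -[RHS]A0.
  exact: act1.
have AE t c : 0 <= t -> A t c = act (h t) (k t) (rmul mu0) c.
  move=> t0; rewrite -[LHS](act_inv _ _ (hk t t0)) /act.
  by apply: eq_bigr => d _; rewrite -[in RHS](actA t)// /act.
have PA t : 0 <= t -> P t = gram (A t).
  move=> t0; apply/Pmat_gram/skew_bracket_rmul => c b i; rewrite -!/(A t _) !AE//.
  exact: skewf_act.
have PE t : 0 <= t ->
    P t = h t *m Bform (rmul mu0) (k t *m (k t)^T) (k t *m (k t)^T) *m (h t)^T.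
  move=> t0; rewrite PA// -gram_act /gram; congr (_ *: _); apply: eq_bigr => c _.
  by rewrite AE.
(* Since [k h = 1], the derivative [2 k P k^T] of [k k^T] collapses to [2 B(k k^T, k k^T)]. *)
have kkT t : 0 <= t -> k t *m (k t)^T = Hsol t.
  apply: (Hsol_unique skA nil0 (X := fun t => k t *m (k t)^T)); last by rewrite k0 trmx1 mulmx1.
  apply: (mc1_eq (mc1M dk (mc1_tr dk))) => s /ltW s0.
  rewrite trmx_mul Pmat_sym -/(P s) mulmxA -mulr2n -scaler_nat; congr (_ *: _).
  rewrite PE// !mulmxA kh// mul1mx -mulmxA -trmx_mul kh// trmx1 mulmx1.
  by [].
exists h; split => // t t0; split.
- rewrite PE// kkT// dHsolE//; move: (Bform _ _ _) => B.
  by rewrite -!scalemxAr -!scalemxAl scalerA mulVf ?scale1r// pnatr_eq0.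
- by rewrite -kkT// mulmxA hk// mul1mx -trmx_mul hk// trmx1.
(* If the norm vanishes at [t], so does the bracket, and transporting it back to time 0 gives
   [mu0 = 0]. *)
move=> nu0; apply: rmul_inj => c; rewrite -(actA t)// /act big1 => [|d _].
  by apply/matrixP => a b; rewrite !mxE.
have -> : A t d = 0.
  by apply: gram_trace_eq0; rewrite -PA// /P (max_idPl t0) -bnorm2_trace.
by rewrite mulmx0 mul0mx scaler0.
Qed.

Lemma bnorm2_bounds : (exists i j, mu0 i j != 0) -> forall t : R, 0 < t ->
  ((2 * (m ^ 2)%:R) * t + (bnorm2 mu0)^-1)^-1 <= bnorm2 (nu t) /\
  bnorm2 (nu t) <= (2^-1 * ((Hdeg K)%:R * m%:R)) * t^-1.
Proof.
move=> nz; have [h [dh hP]] := flow_gauge.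
pose G t := \tr (P t).
have PG t : 0 <= t -> bnorm2 (nu t) = G t.
  by move=> t0; rewrite bnorm2_trace /G /P (max_idPl t0).
have Pmax t : P (Num.max t 0) = P t by rewrite /P -maxA maxxx.
have max0 (t : R) : 0 <= Num.max t 0 by rewrite le_max lexx orbT.
have psdP t : psd (P t).
  rewrite -Pmax; have [-> _ _] := hP _ (max0 t).
  apply: psdZ; first by rewrite invr_ge0.
  by apply/psd_congr/psd_dHsol.
(* A nonzero initial bracket never reaches zero, so [1 / G] makes sense in the lower bound. *)
have Gn0 t : G t != 0.
  apply/negP => /eqP Gt; have [_ _ HH] := hP _ (max0 t).
  have [i [j]] := nz; rewrite HH ?eqxx//.
  by rewrite PG// /G Pmax.
have Ggt0 t : 0 < G t by rewrite lt_def Gn0 psd_trace_ge0.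
have cG : continuous G by apply: continuous_sum => i; exact: continuous_Pmat.
(* The derivative of [tr (h H' h^T) / 2]: the equation [h' = - P h] enters on both sides, and
   [h H' h^T = 2 P] gives [- 2 tr (P^2)]. *)
pose g' s := 2^-1 * \tr (h s *m ddHsol s *m (h s)^T) - 2 * \tr (P s *m P s).
have dG : c1 G g'.
  have dH : mc1 dHsol ddHsol by exact: mc1_evmx.
  have dtr := c1M (c1_cst 2^-1) (mc1_trace (mc1M (mc1M dh dH) (mc1_tr dh))).
  have dtr' := c1_near cG dtr.
  apply: (c1_eq (dtr' _)) => [t t0|s /ltW s0].
    by have [PE _ _] := hP _ t0; rewrite /G PE mxtraceZ.
  rewrite mul0r add0r.
  have P2 : h s *m dHsol s *m (h s)^T = 2 *: P s.
    by have [-> _ _] := hP _ s0; rewrite scalerA divff ?scale1r// pnatr_eq0.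
  rewrite [(- _)^T]linearN/= trmx_mul Pmat_sym -/(P s) mulmxDl mulNmx mulmxN mulmxA.
  rewrite P2 mulNmx -!mulmxA (mulmxA (h s) (dHsol s)) P2.
  rewrite -scalemxAl -scalemxAr mulmxA !mxtraceD !raddfN /= !mxtraceZ /g'.
  by field.
have g'ge s : 0 < s -> - (2 * (m ^ 2)%:R) * G s ^+ 2 <= g' s.
  move=> s0; have := psd_trace_sqr (psdP s).
  have : 0 <= \tr (h s *m ddHsol s *m (h s)^T).
    by apply/psd_trace_ge0/psd_congr/psd_ddHsol => //; exact: ltW.
  by rewrite /g' -/(G s); lra.
move=> t t0; split.
  pose C := 2 * (m ^ 2)%:R : R.
  (* The function [1 / G - C t] is nonincreasing, because [G' >= - C G^2]. *)
  have dV := c1D (c1V dG Gn0) (c1N (c1M (c1_cst C) (@c1_id R))).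
  have := c1_ler0 dV (ltW t0).
  have G0 : G 0 = bnorm2 mu0.
    rewrite -PG//; apply: eq_bigr => i _; apply: eq_bigr => j _.
    by rewrite solnu.1.
  rewrite mulr0 subr0 G0 lerBlDr addrC => Hle.
  rewrite PG ?(ltW t0)// -[leRHS]invrK lef_pV2 ?posrE ?invr_gt0//.
    apply: Hle => s /andP[s0 _]; rewrite mul0r add0r mulr1 subr_le0.
    rewrite mulNr lerNl ler_pdivlMl ?exprn_gt0//.
    by have := g'ge s s0; rewrite mulrN mulNr mulrC.
  by rewrite ltr_wpDl// ?mulr_ge0// ?ltW// invr_gt0 -G0.
rewrite PG ?(ltW t0)// ler_pdivlMr//.
have [PE hH _] := hP _ (ltW t0).
(* The trace of [h (Hdeg H - t H') h^T] is [Hdeg m - 2 t G], because [h H h^T = 1]. *)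
have := psd_trace_ge0 (psd_congr (h t) (psd_deg_Hsol skA nil0 (ltW t0))).
rewrite mulmxBr mulmxBl -!scalemxAr -!scalemxAl hH raddfB /= !mxtraceZ mxtrace1.
rewrite /G PE mxtraceZ; lra.
Qed.

End Flow.

(** * Decay at infinity and the choice of the constant *)

Lemma cvg0_of_le_inv (R : realType) (f : R -> R) (C : R) :
  (forall t, 0 <= f t) -> (forall t, 0 < t -> f t <= C * t^-1) ->
  f x @[x --> +oo] --> (0 : R).
Proof.
move=> f0 fC; apply/cvgrPdist_le => e e0.
near=> t; rewrite sub0r normrN ger0_norm//.
have t0 : 0 < t by near: t; apply: nbhs_pinfty_gt; exact: num_real.
have tC : C / e <= t by near: t; apply: nbhs_pinfty_ge; exact: num_real.
by apply: (le_trans (fC t t0)); rewrite ler_pdivrMr// mulrC -ler_pdivrMr.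
Unshelve. all: by end_near.
Qed.

Unset Implicit Arguments.

Theorem theorem3p10 (R : realType) (n : nat) (J : 'M[R]_(2 * n))
  (mu0 : bracket R (2 * n)) :
  J *m J = - 1%:M -> J^T *m J = 1%:M ->
  in_C J mu0 -> nilpotent_bracket mu0 -> (exists i j, mu0 i j != 0) ->
  (exists mu : R -> bracket R (2 * n), bracket_flow_sol mu0 mu) /\
  (exists C : R, 0 < C /\
     forall mu : R -> bracket R (2 * n), bracket_flow_sol mu0 mu ->
       (forall t : R, 0 < t ->
          (C * t + (bnorm2 mu0)^-1)^-1 <= bnorm2 (mu t) /\
          bnorm2 (mu t) <= C * t^-1) /\
       (bnorm2 (mu x) @[x --> +oo] --> (0 : R))).
Proof.
move=> _ _ [sk0 _] /nilpotent_Zm[K nil0] nz; split.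
  exact: flow_exists sk0 nil0.
(* A nonzero value of [mu0] supplies an index, so the dimension is positive and hence [a > 0]. *)
have n0 : (0 < 2 * n)%N by have [i _] := nz; exact: leq_ltn_trans (ltn_ord i).
pose a : R := 2 * ((2 * n) ^ 2)%:R.
pose b : R := 2^-1 * ((Hdeg K)%:R * (2 * n)%:R).
have a0 : 0 < a by rewrite mulr_gt0// ltr0n expn_gt0 n0.
have b0 : 0 <= b by rewrite !mulr_ge0// invr_ge0.
have bounds mu t : bracket_flow_sol mu0 mu -> 0 < t ->
    (a * t + (bnorm2 mu0)^-1)^-1 <= bnorm2 (mu t) /\ bnorm2 (mu t) <= b * t^-1.
  by move=> sol; exact: (bnorm2_bounds sk0 nil0 sol nz).
clearbody a b; have C0 : 0 < a + b + 1 by lra.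
(* Raising the constant weakens both bounds, so a single constant, chosen before the solution,
   serves for both. *)
exists (a + b + 1); split=> // mu sol; split.
  move=> t t0; have [lo up] := bounds mu t sol t0.
  have n00 : 0 <= (bnorm2 mu0)^-1 by rewrite invr_ge0 bnorm2_ge0.
  split; [apply: le_trans lo|apply: le_trans up _].
    by rewrite lef_pV2 ?posrE ?ltr_pwDl ?mulr_gt0// lerD2r ler_pM2r//; lra.
  by rewrite ler_pM2r ?invr_gt0//; lra.
apply: (@cvg0_of_le_inv _ _ b) => t; first exact: bnorm2_ge0.
by move=> /(bounds mu t sol)[].
Qed.
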